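(* Let $n$ be an odd positive integer and let $Q\subseteq\mathbb{R}^{n-1}$ be the convex hull of all dual degree partitions $(d^*_1,\ldots,d^*_{n-1})$ of simple graphs on $n$ vertices. Then the facet-defining inequalities of $Q$ are the $n$ inequalities \[ n \geq x_1 \geq x_2 \geq \cdots \geq x_{n-1} \geq 0 \] together with the inequality \[ (x_1-x_2)+(x_3-x_4)+\cdots+(x_{n-2}-x_{n-1}) \leq n-1. \] The extreme points of $Q$ are the following $\frac{(n+1)^2}{4}$ points: the $\frac{n+1}{2}$ points \[ \mathbf{a}^{(k)} = (\underbrace{n,\ldots,n}_{2k},\underbrace{0,\ldots,0}_{n-1-2k}), \quad 0\le 2k\le n-1; \] the $\frac{n^2-1}{8}$ points \[ \mathbf{b}^{(k,l)} = (\underbrace{n,\ldots,n}_{2k},\underbrace{n-1,\ldots,n-1}_{2l+1},\underbrace{0,\ldots,0}_{n-2-2k-2l}), \quad 0\le 2k+2l\le n-3; \] and the $\frac{n^2-1}{8}$ points \[ \mathbf{c}^{(k,l)} = (\underbrace{n,\ldots,n}_{2k+1},\underbrace{1,\ldots,1}_{2l+1},\underbrace{0,\ldots,0}_{n-3-2k-2l}), \quad 0\le 2k+2l\le n-3, \] where $k,l$ range over nonnegative integers.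
   Context: All graphs are simple (undirected, no loops, no multiple edges) on the vertex set $\{1,\ldots,n\}$. The degree $d_i$ of vertex $i$ is its number of neighbors; vertices are labeled so that $n-1\ge d_1\ge\cdots\ge d_n\ge 0$, and $\mathbf{d}=(d_1,\ldots,d_n)$ is the degree partition. The dual degree partition of the graph is $\mathbf{d}^*=(d^*_1,\ldots,d^*_n)$ where $d^*_j=|\{i : d_i\ge j\}|$, so $n\ge d^*_1\ge\cdots\ge d^*_n=0$. Since $d^*_n=0$ always, each dual degree partition is regarded as the point $(d^*_1,\ldots,d^*_{n-1})\in\mathbb{R}^{n-1}$ (the last coordinate is suppressed).
   Formalization: The claim about facet-defining inequalities is made only for odd n ≥ 3, because for n = 1 the polytope is a single point and the last inequality reads 0 ≤ 0, which defines no facet; all other claims cover every odd n. *)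

(* Defs.v *)
From HB Require Import structures.
From mathcomp Require Import all_boot all_order all_algebra.
From mathcomp Require Import all_classical all_reals convex.

Set Implicit Arguments.
Unset Strict Implicit.
Unset Printing Implicit Defensive.

Import Order.TTheory GRing.Theory Num.Theory.

Local Open Scope classical_set_scope.
Local Open Scope ring_scope.

(* Vertex i of {1,...,n} is the ordinal of value i - 1. *)
Record sgraph (n : nat) := SGraph {
  edge : rel 'I_n;
  edge_sym : symmetric edge;
  edge_irr : irreflexive edge }.

Definition degree n (G : sgraph n) (i : 'I_n) : nat := #|edge G i|.

Definition degree_partition n (G : sgraph n) : seq nat :=
  sort geq [seq degree G i | i <- enum 'I_n].

Definition dual_degree n (G : sgraph n) (j : nat) : nat :=
  count (fun d => j <= d)%N (degree_partition G).

(* Vectors of R^(n-1) are indexed from 0: entry j is the coordinate x_(j+1). *)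
Definition dual_degree_vector (R : realType) n (G : sgraph n) : 'rV[R]_n.-1 :=
  \row_(j < n.-1) (dual_degree G j.+1)%:R.

Definition convex_hull (R : realType) m (A : set 'rV[R]_m) : set 'rV[R]_m :=
  smallest (fun B : set 'rV[R]_m => convex_set B) A.

Definition extreme_points (R : realType) m (A : set 'rV[R]_m) : set 'rV[R]_m :=
  [set x | A x /\ forall (y z : 'rV[R]_m) (t : R), A y -> A z -> 0 < t < 1 ->
                  x = t *: y + (1 - t) *: z -> y = x /\ z = x].

Definition affinely_independent (R : realType) m k (v : 'I_k -> 'rV[R]_m) : Prop :=
  forall c : 'I_k -> R, \sum_i c i = 0 -> \sum_i c i *: v i = 0 ->
  forall i, c i = 0.

(* The affine dimension of A is d; it holds for no d when A is empty. *)
Definition affine_dim (R : realType) m (A : set 'rV[R]_m) (d : nat) : Prop :=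
  (exists v : 'I_d.+1 -> 'rV[R]_m,
      affinely_independent v /\ forall i, A (v i)) /\
  (forall k (v : 'I_k -> 'rV[R]_m),
      affinely_independent v -> (forall i, A (v i)) -> (k <= d.+1)%N).

Definition dotprod (R : realType) m (a x : 'rV[R]_m) : R :=
  \sum_(j < m) a 0 j * x 0 j.

(* A pair (a, b) stands for the inequality a . x <= b. *)
Definition ineq (R : realType) (m : nat) : Type := ('rV[R]_m * R)%type.

Definition valid (R : realType) m (A : set 'rV[R]_m) (f : ineq R m) : Prop :=
  forall x, A x -> dotprod f.1 x <= f.2.

Definition face (R : realType) m (A : set 'rV[R]_m) (f : ineq R m) :
  set 'rV[R]_m := [set x | A x /\ dotprod f.1 x = f.2].

Definition facet_defining (R : realType) m (A : set 'rV[R]_m) (f : ineq R m) :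
  Prop :=
  valid A f /\ exists d : nat, affine_dim A d.+1 /\ affine_dim (face A f) d.

Definition positive_multiple (R : realType) m (f g : ineq R m) : Prop :=
  exists2 c : R, 0 < c & f = (c *: g.1, c * g.2).

Definition dual_degree_polytope (R : realType) (n : nat) : set 'rV[R]_n.-1 :=
  convex_hull (range (@dual_degree_vector R n)).
Arguments dual_degree_polytope : clear implicits.

(* The coordinate x_i for 1 <= i <= n - 1, extended by x_0 = n and x_n = 0, so that
   n >= x_1 >= ... >= x_(n-1) >= 0 reads x_(i+1) <= x_i for 0 <= i < n. *)
Definition xcoord (R : realType) n (x : 'rV[R]_n.-1) (i : nat) : R :=
  if i == 0%N then n%:R else if insub i.-1 is Some j then x 0 j else 0.

(* x_(i+1) - x_i <= 0, with the constant x_0 = n moved to the right. *)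
Definition chain_ineq (R : realType) n (i : 'I_n) : ineq R n.-1 :=
  (\row_(j < n.-1) ((j.+1 == i.+1)%:R - (j.+1 == i :> nat)%:R),
   if i == 0%N :> nat then n%:R else 0).

(* (x_1 - x_2) + ... + (x_(n-2) - x_(n-1)) <= n - 1 *)
Definition alt_ineq (R : realType) (n : nat) : ineq R n.-1 :=
  (\row_(j < n.-1) (-1) ^+ j, n.-1%:R).

Definition listed_ineqs (R : realType) (n : nat) : set (ineq R n.-1) :=
  range (@chain_ineq R n) `|` [set alt_ineq R n].
Arguments listed_ineqs : clear implicits.

Definition point_a (R : realType) (n k : nat) : 'rV[R]_n.-1 :=
  \row_(j < n.-1) if (j < 2 * k)%N then n%:R else 0.

Definition point_b (R : realType) (n k l : nat) : 'rV[R]_n.-1 :=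
  \row_(j < n.-1) if (j < 2 * k)%N then n%:R
                  else if (j < 2 * k + (2 * l + 1))%N then n.-1%:R else 0.

Definition point_c (R : realType) (n k l : nat) : 'rV[R]_n.-1 :=
  \row_(j < n.-1) if (j < 2 * k + 1)%N then n%:R
                  else if (j < (2 * k + 1) + (2 * l + 1))%N then 1 else 0.

Definition points_a (R : realType) (n : nat) : set 'rV[R]_n.-1 :=
  [set x | exists2 k : nat, (2 * k <= n - 1)%N & x = point_a R n k].
Arguments points_a : clear implicits.

(* 2k + 2l <= n - 3 is written without subtraction: no k, l when n < 3. *)
Definition points_b (R : realType) (n : nat) : set 'rV[R]_n.-1 :=
  [set x | exists k l : nat,
             (2 * k + 2 * l + 3 <= n)%N /\ x = point_b R n k l].
Arguments points_b : clear implicits.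

Definition points_c (R : realType) (n : nat) : set 'rV[R]_n.-1 :=
  [set x | exists k l : nat,
             (2 * k + 2 * l + 3 <= n)%N /\ x = point_c R n k l].
Arguments points_c : clear implicits.

(* Main.v *)
Require Import Defs.
From HB Require Import structures.
From mathcomp Require Import all_boot all_order all_algebra.
From mathcomp Require Import all_classical all_reals.
From mathcomp Require Import interval_inference convex zify lra.

(* Write x_0 = n, x_n = 0 and use the gaps y_i = x_i - x_(i+1), 0 <= i < n, as
   coordinates: they sum to n, and y_i counts the vertices of degree i. The chain
   inequalities say y >= 0; the alternating one says that the odd gaps sum to at
   most n - 1, which holds for graphs because n is odd while the number of vertices
   of odd degree is even. So the inequalities cut the simplex {y >= 0, sum y = n}
   by one hyperplane, and an explicit convex combination shows that the result is
   the hull of the points n e_i (i even) and e_i + (n - 1) e_j (i even, j odd).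
   Each of these is the degree count of a graph: a circulant on n vertices, or a
   vertex joined to the ends of some antipodal edges removed from a circulant on
   n - 1 vertices. An inequality valid at these points is an explicit
   nonnegative combination of the listed ones, so a facet lies in a listed face,
   and a rank count makes the two inequalities proportional. *)

Set Implicit Arguments.
Unset Strict Implicit.
Unset Printing Implicit Defensive.

Import Order.TTheory GRing.Theory Num.Theory.

Local Open Scope classical_set_scope.
Local Open Scope card_scope.
Local Open Scope ring_scope.

(** * Convex hulls and gap coordinates *)

Section ConvexHull.
Variables (R : realType) (m : nat).
Implicit Types (A B : set 'rV[R]_m) (x y z : 'rV[R]_m).

Lemma convex_set_comb B x y (t : R) : convex_set B -> B x -> B y ->
  0 <= t <= 1 -> B (t *: x + (1 - t) *: y).
Proof.
move=> cB Bx By /andP[t0 t1].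
have := cB x y (Itv01 t0 t1) (mem_set Bx) (mem_set By).
by rewrite inE.
Qed.

Lemma convex_setP B :
  (forall x y (t : R), B x -> B y -> 0 < t < 1 -> B (t *: x + (1 - t) *: y)) ->
  convex_set B.
Proof.
move=> H; apply/convex_setW => x y; rewrite !inE => Bx By k k0 k1.
have := H x y k%:num Bx By; rewrite k0 k1 => /(_ isT) Bxy.
exact: mem_set.
Qed.

(** Induction on [s] needs normalised partial sums, so the claim is proved for any positive total
    weight. Membership in [B] is asked only at positive weights, since [vtx_weight] vanishes at
    pairs that give no vertex. *)
Lemma convex_set_sum (I : Type) (s : seq I) (w : I -> R) (v : I -> 'rV[R]_m) B :
  convex_set B -> (forall i, 0 <= w i) -> (forall i, 0 < w i -> B (v i)) ->
  \sum_(i <- s) w i = 1 -> B (\sum_(i <- s) w i *: v i).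
Proof.
move=> cB w0 Bv sw.
suff H : 0 < \sum_(i <- s) w i ->
    B ((\sum_(i <- s) w i)^-1 *: \sum_(i <- s) w i *: v i).
  by move: H; rewrite sw invr1 scale1r; apply; exact: ltr01.
move: {sw}s; elim => [|i s IH]; first by rewrite big_nil ltxx.
rewrite !big_cons; set W := \sum_(j <- s) _ in IH *; set V := \sum_(j <- s) _ in IH *.
have W0 : 0 <= W by apply: sumr_ge0.
have V0 : W = 0 -> V = 0.
  move=> W00; rewrite /V; move: W00; rewrite /W.
  elim: (s) => [|j r IHr]; first by rewrite !big_nil.
  rewrite !big_cons => /eqP; rewrite paddr_eq0 ?sumr_ge0 // => /andP[/eqP -> /eqP].
  by move=> /IHr ->; rewrite scale0r addr0.
move: (w0 i); rewrite le_eqVlt => /predU1P[<-|wi].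
  by rewrite !add0r scale0r add0r.
move: W0; rewrite le_eqVlt => /predU1P[W00|Wgt0].
  rewrite -W00 V0 // !addr0 scalerA mulVf ?scale1r ?gt_eqF // => _.
  exact: Bv.
move=> D0.
have -> : (w i + W)^-1 *: (w i *: v i + V) =
  (w i / (w i + W)) *: v i + (1 - w i / (w i + W)) *: (W^-1 *: V).
  rewrite scalerDr !scalerA -[X in X - _](divff (lt0r_neq0 D0)) -mulrBl addrAC subrr add0r.
  by rewrite mulrC [W / _]mulrC mulfK ?lt0r_neq0.
apply: convex_set_comb => //; [exact: Bv|exact: IH|].
by rewrite ler_pdivrMr // mul1r lerDl (ltW Wgt0) divr_ge0 // ltW.
Qed.

Lemma convex_hull_convex A : convex_set (convex_hull A).
Proof.
apply: convex_setP => x y t Hx Hy /andP[t0 t1] B [cB AB].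
have Bx : B x by exact: Hx (conj cB AB).
have By : B y by exact: Hy (conj cB AB).
by apply: convex_set_comb => //; rewrite (ltW t0) (ltW t1).
Qed.

Lemma sub_convex_hull A : A `<=` convex_hull A.
Proof. by move=> x Ax B [_]; apply. Qed.

Lemma convex_hull_min A B : convex_set B -> A `<=` B -> convex_hull A `<=` B.
Proof. by move=> cB AB x; apply. Qed.

(** Deleting an extreme point from a convex set leaves it convex. Were the point outside [A], the
    rest of the hull would be a smaller convex set containing [A]. *)
Lemma extreme_points_convex_hull A : extreme_points (convex_hull A) `<=` A.
Proof.
move=> x [Hx ext]; apply: contrapT => nAx.
suff sub : convex_hull A `<=` convex_hull A `\ x by have [_] := sub x Hx; apply.
apply: convex_hull_min => [|z Az]; last first.
  by split; [exact: sub_convex_hull|move=> zx; apply: nAx; rewrite -zx].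
apply: convex_setP => y z t [Hy yx] [Hz zx] t01; split.
  case/andP: (t01) => t0 t1.
  apply: convex_set_comb => //; first exact: convex_hull_convex.
  by rewrite (ltW t0) (ltW t1).
by move=> e; case: (ext y z t Hy Hz t01 (esym e)) => /yx.
Qed.

End ConvexHull.

(** * Affine functionals in gap coordinates *)

Section Gaps.
Variables (R : realType) (n : nat).
Hypothesis n_gt0 : (0 < n)%N.
Implicit Types (x : 'rV[R]_n.-1) (f g : ineq R n.-1).

Definition gap x (i : nat) : R := xcoord x i - xcoord x i.+1.

Definition slack f x : R := f.2 - dotprod f.1 x.

(** Coefficients of the slack as a linear form in the gaps: since the gaps sum to n, the constant
    spreads as [f.2 / n] over each gap, and x_(j+1), in column [j], is the sum of the gaps of index
    above [j]. *)
Definition gap_coef f (i : nat) : R :=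
  f.2 / n%:R - \sum_(j < n.-1 | (j < i)%N) f.1 0 j.

Lemma xcoordS x (j : 'I_n.-1) : xcoord x j.+1 = x 0 j.
Proof. by rewrite /xcoord /= valK. Qed.

Lemma xcoord_last x : xcoord x n = 0.
Proof.
rewrite /xcoord gtn_eqF // ; case: insubP => // j.
by rewrite ltnn.
Qed.

Lemma natr_n_neq0 : n%:R != 0 :> R.
Proof. by rewrite pnatr_eq0 -lt0n. Qed.

Lemma sum_gap_tail x j : (j <= n)%N ->
  \sum_(i < n | (j <= i)%N) gap x i = xcoord x j.
Proof.
move=> jn; rewrite -(big_geq_mkord j n xpredT (gap x)).
rewrite (eq_bigr (fun i => - (xcoord x i.+1 - xcoord x i))); last first.
  by move=> i _; rewrite opprB.
by rewrite sumrN telescope_sumr // opprB xcoord_last subr0.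
Qed.

Lemma sum_gap x : \sum_(i < n) gap x i = n%:R.
Proof. by have := sum_gap_tail x (leq0n n); rewrite /xcoord /=. Qed.

Lemma slack_gap f x : slack f x = \sum_(i < n) gap_coef f i * gap x i.
Proof.
under eq_bigr do rewrite mulrBl.
rewrite big_split /= -mulr_sumr sum_gap divfK ?natr_n_neq0 // sumrN.
congr (_ - _); rewrite /dotprod.
under [RHS]eq_bigr do rewrite mulr_suml big_mkcond /=.
rewrite exchange_big /=; apply: eq_bigr => j _.
rewrite -big_mkcond /= -mulr_sumr sum_gap_tail ?xcoordS //.
by have := ltn_ord j; lia.
Qed.

Lemma gap_inj x y : (forall i, (i < n)%N -> gap x i = gap y i) -> x = y.
Proof.
move=> e; apply/rowP => j; rewrite -!xcoordS -!sum_gap_tail; last 2 first.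
- by have := ltn_ord j; lia.
- by have := ltn_ord j; lia.
by apply: eq_bigr => i _; apply: e.
Qed.

(** The coefficient of gap 0 is [f.2 / n], and each entry of [f.1] is the difference of two
    consecutive coefficients. *)
Lemma gap_coef_inj f g : (forall i : 'I_n, gap_coef f i = gap_coef g i) -> f = g.
Proof.
case: f g => a b [a' b'] e.
have := e (Ordinal n_gt0); rewrite /gap_coef /= !big_pred0_eq !subr0.
move/(mulIf (invr_neq0 natr_n_neq0)) => bb'; congr pair => //.
apply/rowP => j.
have ltj : (j < n)%N by have := ltn_ord j; lia.
have ltSj : (j.+1 < n)%N by have := ltn_ord j; lia.
have := e (Ordinal ltj); have := e (Ordinal ltSj); rewrite /gap_coef /= bb'.
move=> /addrI /oppr_inj e1 /addrI /oppr_inj e2; move: e1.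
rewrite (bigD1 j) //= [in RHS](bigD1 j) //=.
have P : (fun i : 'I_n.-1 => (i < j.+1)%N && (i != j)) =1 (fun i => (i < j)%N).
  by move=> i; rewrite -val_eqE /=; lia.
by rewrite (eq_bigl _ _ P) [in RHS](eq_bigl _ _ P) e2 => /addIr.
Qed.

Lemma gap_coefZ (c : R) f i : gap_coef (c *: f.1, c * f.2) i = c * gap_coef f i.
Proof.
rewrite /gap_coef /= mulrBr mulrA mulr_sumr; congr (_ - _).
by apply: eq_bigr => j _; rewrite mxE.
Qed.

Lemma slackZ (c : R) f x : slack (c *: f.1, c * f.2) x = c * slack f x.
Proof.
rewrite /slack /= mulrBr /dotprod mulr_sumr; congr (_ - _).
by apply: eq_bigr => j _; rewrite mxE mulrA.
Qed.

(** Serves both for weights of sum 1, where it says that the slack is affine, and for affine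
    dependencies, where the right side is 0. *)
Lemma slack_sum f (I : Type) (s : seq I) (c : I -> R) (v : I -> 'rV[R]_n.-1) :
  \sum_(i <- s) c i * slack f (v i) =
  (\sum_(i <- s) c i) * f.2 - dotprod f.1 (\sum_(i <- s) c i *: v i).
Proof.
under eq_bigr do rewrite mulrBr.
rewrite big_split /= -mulr_suml sumrN; congr (_ - _); rewrite /dotprod.
under [RHS]eq_bigr do rewrite summxE mulr_sumr.
rewrite exchange_big /=; apply: eq_bigr => i _; rewrite mulr_sumr.
by apply: eq_bigr => j _; rewrite mxE mulrCA.
Qed.

Lemma slack_comb f x y (t : R) :
  slack f (t *: x + (1 - t) *: y) = t * slack f x + (1 - t) * slack f y.
Proof.
rewrite /slack; have -> : dotprod f.1 (t *: x + (1 - t) *: y) =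
    t * dotprod f.1 x + (1 - t) * dotprod f.1 y; last by lra.
rewrite /dotprod !mulr_sumr -big_split; apply: eq_bigr => j _ /=.
by rewrite !mxE; lra.
Qed.

(** Makes each gap the slack of a chain inequality, so that gaps inherit the affine behaviour of
    slacks. *)
Lemma gap_coef_chain (i k : 'I_n) : gap_coef (chain_ineq R i) k = (k == i)%:R.
Proof.
have kn : (k <= n.-1)%N by have := ltn_ord k; lia.
rewrite /gap_coef /=.
have -> : \sum_(j < n.-1 | (j < k)%N)
    (\row_(j < n.-1) ((j.+1 == i.+1)%:R - (j.+1 == i :> nat)%:R)) 0 j =
    (i == 0 :> nat)%:R - (k == i)%:R :> R.
  under eq_bigr do rewrite mxE.
  rewrite -(big_ord_widen _ (fun j => (j.+1 == i.+1)%:R - (j.+1 == i :> nat)%:R) kn).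
  rewrite -(big_mkord xpredT (fun j => (j.+1 == i.+1)%:R - (j.+1 == i :> nat)%:R)).
  rewrite (@telescope_sumr_eq _ 0 k (fun j => - (j == i :> nat)%:R)) //.
    by rewrite opprK addrC (eq_sym 0%N) -val_eqE.
  by move=> j _; rewrite opprK addrC.
case: eqP => [i0|i0]; last by rewrite mul0r sub0r opprB subr0.
by rewrite divff ?natr_n_neq0 // opprB addrCA subrr addr0.
Qed.

Lemma gap_coef_alt (k : 'I_n) :
  gap_coef (alt_ineq R n) k = n.-1%:R / n%:R - (odd k)%:R.
Proof.
have kn : (k <= n.-1)%N by have := ltn_ord k; lia.
rewrite /gap_coef /=; congr (_ - _).
under eq_bigr do rewrite mxE.
rewrite -(big_ord_widen _ (fun j => (-1) ^+ j) kn).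
rewrite -(big_mkord xpredT (fun j => (-1) ^+ j)).
(* The signs (-1)^j are the increments of the parity of j. *)
rewrite (@telescope_sumr_eq _ 0 k (fun j => (odd j)%:R)) ?subr0 //.
move=> j _; rewrite -signr_odd /=.
by case: (odd j); rewrite ?expr0 ?expr1 ?sub0r ?subr0.
Qed.

Lemma slack_chain (i : 'I_n) x : slack (chain_ineq R i) x = gap x i.
Proof.
rewrite slack_gap (bigD1 i) //= gap_coef_chain eqxx mul1r big1 ?addr0 // => k ki.
by rewrite gap_coef_chain (negbTE ki) mul0r.
Qed.

Definition odd_gap x : R := \sum_(i < n | odd i) gap x i.
Definition even_gap x : R := \sum_(i < n | ~~ odd i) gap x i.

Lemma odd_even_gap x : odd_gap x + even_gap x = n%:R.
Proof. by rewrite -(sum_gap x) [RHS](bigID (fun i : 'I_n => odd i)). Qed.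

Lemma slack_alt x : slack (alt_ineq R n) x = n.-1%:R - odd_gap x.
Proof.
rewrite slack_gap; under eq_bigr do rewrite gap_coef_alt mulrBl.
rewrite big_split /= -mulr_sumr sum_gap divfK ?natr_n_neq0 // sumrN.
congr (_ - _); rewrite /odd_gap [RHS]big_mkcond; apply: eq_bigr => i _.
by case: odd; rewrite ?mul1r ?mul0r.
Qed.

Lemma gap_comb x y (t : R) (i : 'I_n) :
  gap (t *: x + (1 - t) *: y) i = t * gap x i + (1 - t) * gap y i.
Proof. by rewrite -!slack_chain slack_comb. Qed.

Lemma gap_sum (I : Type) (s : seq I) (c : I -> R) (v : I -> 'rV[R]_n.-1) (i : 'I_n) :
  \sum_(k <- s) c k = 1 ->
  gap (\sum_(k <- s) c k *: v k) i = \sum_(k <- s) c k * gap (v k) i.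
Proof.
move=> c1; under [RHS]eq_bigr do rewrite -slack_chain.
by rewrite slack_sum c1 mul1r -slack_chain.
Qed.

End Gaps.

(** * Vertices of the gap polytope *)

Section Vertices.
Variables (R : realType) (n : nat).
Hypothesis n_gt0 : (0 < n)%N.
Implicit Types (x y z : 'rV[R]_n.-1).

(* The point with gap vector e_i + (n - 1) e_j; for j = i this is n e_i. *)
Definition vtx (i j : nat) : 'rV[R]_n.-1 :=
  \row_(k < n.-1) ((k < i)%:R + n.-1%:R * (k < j)%:R).

Definition vertices : set 'rV[R]_n.-1 :=
  [set x | exists i j : 'I_n, [/\ ~~ odd i, odd j || (j == i) & x = vtx i j]].

Definition gap_polytope : set 'rV[R]_n.-1 :=
  [set x | (forall i : 'I_n, 0 <= gap x i) /\ odd_gap x <= n.-1%:R].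

Lemma natr_n : n%:R = 1 + n.-1%:R :> R.
Proof. by rewrite -{1}(prednK n_gt0) -natr1 addrC. Qed.

Lemma xcoord_vtx (i j k : nat) : (i < n)%N -> (j < n)%N -> (k <= n)%N ->
  xcoord (vtx i j) k = (k <= i)%:R + n.-1%:R * (k <= j)%:R.
Proof.
move=> ilt jlt; rewrite leq_eqVlt => /predU1P[->|klt].
  by rewrite xcoord_last // leqNgt ilt leqNgt jlt mulr0 addr0.
case: k klt => [|k] klt; first by rewrite /xcoord /= mulr1 natr_n.
have klt' : (k < n.-1)%N by lia.
by rewrite (xcoordS _ (Ordinal klt')) mxE.
Qed.

Lemma gap_vtx (i j k : 'I_n) :
  gap (vtx i j) k = (k == i)%:R + n.-1%:R * (k == j)%:R.
Proof.
rewrite /gap !xcoord_vtx ?ltn_ord // ?(ltnW (ltn_ord k)) //.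
have E (l : 'I_n) : (k == l)%:R = (k <= l)%:R - (k < l)%:R :> R.
  by rewrite -val_eqE /=; case: ltngtP; rewrite ?subrr ?subr0.
by rewrite !E mulrBr; lra.
Qed.

Lemma odd_gap_vtx (i j : 'I_n) : ~~ odd i -> odd_gap (vtx i j) = n.-1%:R * (odd j)%:R.
Proof.
move=> ei; rewrite /odd_gap.
under eq_bigr => k ok.
  rewrite gap_vtx (_ : k == i = false) ?add0r; last first.
    by apply: contraTF ok => /eqP ->.
  over.
rewrite -mulr_sumr; congr (_ * _).
case: (boolP (odd j)) => oj.
  rewrite (bigD1 j) //= eqxx big1 ?addr0 // => k /andP[_ kj].
  by rewrite (negbTE kj).
rewrite big1 // => k ok; rewrite (_ : k == j = false) //.
by apply: contraTF ok => /eqP ->.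
Qed.

Lemma gap_polytope_convex : convex_set gap_polytope.
Proof.
apply: convex_setP => x y t [x0 xo] [y0 yo] /andP[/ltW t0 /ltW t1].
have {}t1 : 0 <= 1 - t by rewrite subr_ge0.
split => [i|]; first by rewrite gap_comb // addr_ge0 // mulr_ge0.
rewrite -subr_ge0 -slack_alt // slack_comb !slack_alt //.
by rewrite addr_ge0 // mulr_ge0 // subr_ge0.
Qed.

Lemma vertices_gap_polytope : vertices `<=` gap_polytope.
Proof.
move=> _ [i [j [ei oj ->]]]; split => [k|].
  by rewrite gap_vtx addr_ge0 // mulr_ge0.
by rewrite odd_gap_vtx //; case: odd; rewrite ?mulr1 ?mulr0.
Qed.

Section Coefficients.
Variable x : 'rV[R]_n.-1.
Let D := even_gap x * n.-1%:R.
Let a := odd_gap x / D.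

(** Product weights. Gap j of the combination, for j odd, collects a factor n - 1 and the sum of the
    even gaps, which [D] cancels. The odd second indices take the share [a] of gap i, for i even;
    the weight [(1 - a) / n] on n e_i supplies the remaining 1 - a. *)
Definition vtx_weight (p : 'I_n * 'I_n) : R :=
  if odd p.1 then 0 else gap x p.1 *
    (if odd p.2 then gap x p.2 / D else (p.2 == p.1)%:R * ((1 - a) / n%:R)).

Lemma sum_vtx_weight (F : 'I_n -> 'I_n -> R) :
  \sum_p vtx_weight p * F p.1 p.2 =
  \sum_(i < n | ~~ odd i) gap x i *
    (\sum_(j < n | odd j) gap x j / D * F i j + (1 - a) / n%:R * F i i).
Proof.
rewrite -(pair_bigA _ (fun i j => vtx_weight (i, j) * F i j)) /=.
rewrite [RHS]big_mkcond; apply: eq_bigr => i _; rewrite /vtx_weight /=.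
case: (boolP (odd i)) => oi /=; first by rewrite big1 // => j _; rewrite mul0r.
under eq_bigr do rewrite -mulrA.
rewrite -mulr_sumr; congr (_ * _).
rewrite (bigID (fun j : 'I_n => odd j)) /=; congr (_ + _).
  by apply: eq_bigr => j ->.
rewrite (bigD1 i) //= (negbTE oi) eqxx mul1r big1 ?addr0 // => j /andP[oj ji].
by rewrite (negbTE oj) (negbTE ji) !mul0r.
Qed.

Hypothesis Px : gap_polytope x.

Let E_ge1 : 1 <= even_gap x.
Proof.
by have := odd_even_gap n_gt0 x; case: Px => _; rewrite natr_n; lra.
Qed.

Let O_ge0 : 0 <= odd_gap x.
Proof. by apply: sumr_ge0 => i _; case: Px. Qed.

Let D_ge0 : 0 <= D.
Proof. by apply: mulr_ge0; rewrite ?ler0n // (le_trans ler01 E_ge1). Qed.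

Let aD : a * D = odd_gap x.
Proof.
(* The even gaps sum to at least 1, so [D] vanishes only for n = 1; then the odd gaps sum to 0
   too. *)
rewrite /a; have [D0|D0] := eqVneq D 0; last by rewrite divfK.
have : n.-1%:R = 0 :> R.
  move/eqP: D0; rewrite /D mulf_eq0 => /orP[/eqP E0|/eqP //].
  by move: E_ge1; rewrite E0 ler10.
case: Px => _ + n0; rewrite n0 D0 mulr0 => ?.
by apply/eqP; rewrite eq_le O_ge0.
Qed.

(** The alternating inequality enters twice: the odd gaps sum to at most n - 1, and therefore the
    even ones to at least 1, so that n - 1 is at most [D]. *)
Let a_le1 : a <= 1.
Proof.
rewrite /a; move: D_ge0; rewrite le_eqVlt => /predU1P[<-|D0].
  by rewrite invr0 mulr0.
rewrite ler_pdivrMr // mul1r (le_trans Px.2) // /D.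
by rewrite ler_peMl.
Qed.

Lemma vtx_weight_ge0 p : 0 <= vtx_weight p.
Proof.
case: Px => g0 _; rewrite /vtx_weight; case: ifP => // _.
rewrite mulr_ge0 //; case: ifP => _; first by rewrite divr_ge0.
by rewrite !mulr_ge0 // ?invr_ge0 // subr_ge0.
Qed.

Lemma vtx_weight_gt0 p : 0 < vtx_weight p -> vertices (vtx p.1 p.2).
Proof.
case: p => i j; rewrite /vtx_weight /=; case: ifP; rewrite ?ltxx // => ei H.
exists i, j; split; rewrite ?ei //.
by move: H; case: odd => //=; case: eqP => // _; rewrite mul0r mulr0 ltxx.
Qed.

Let sum_odd : \sum_(j < n | odd j) gap x j / D = a.
Proof. by rewrite -mulr_suml. Qed.

Lemma vtx_weight_sum : \sum_p vtx_weight p = 1.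
Proof.
transitivity (\sum_p vtx_weight p * (fun _ _ => 1) p.1 p.2).
  by apply: eq_bigr => p _; rewrite mulr1.
rewrite (sum_vtx_weight (fun _ _ => 1)); under eq_bigr do under eq_bigr do rewrite mulr1.
rewrite mulr1 sum_odd -mulr_suml -/(even_gap x).
(* With E the sum of the even gaps, n times the total is E (a (n - 1) + 1) = a D + E, the sum of all
   gaps. *)
apply: (mulIf (natr_n_neq0 R n_gt0)); rewrite mul1r -mulrA mulrDl divfK ?natr_n_neq0 //.
rewrite -[RHS](odd_even_gap n_gt0 x) -aD /D natr_n.
lra.
Qed.

Lemma vtx_weight_comb : \sum_p vtx_weight p *: vtx p.1 p.2 = x.
Proof.
apply: (gap_inj n_gt0) => k' klt; pose k := Ordinal klt.
rewrite -[k']/(k : nat) gap_sum //; last exact: vtx_weight_sum.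
under eq_bigr do rewrite gap_vtx.
rewrite (sum_vtx_weight (fun i j => (k == i)%:R + n.-1%:R * (k == j)%:R)).
case: (boolP (odd k)) => ok.
  under eq_bigr => i ei.
    have -> : k == i = false by apply: contraNF ei => /eqP <-.
    rewrite !(mulr0, add0r, addr0).
    rewrite (bigD1 k) //= eqxx mulr1 big1 ?addr0; last first.
      by move=> j /andP[_ jk]; rewrite eq_sym (negbTE jk) mulr0 add0r mulr0.
    over.
  rewrite -mulr_suml -/(even_gap x) add0r.
  have D0 : D != 0.
    rewrite mulf_neq0 //; first by rewrite gt_eqF // (lt_le_trans ltr01).
    rewrite pnatr_eq0; have : odd k' := ok.
    by move: (klt); case: (k') => //=; lia.
  by rewrite mulrCA -[X in _ * X]/D divfK.
rewrite (bigD1 k) //= [X in _ + X]big1 ?addr0; last first.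
  move=> i /andP[ei ik]; rewrite (eq_sym k) (negbTE ik) !(mulr0, addr0).
  rewrite big1 ?mulr0 // => j oj.
  by rewrite (_ : k == j = false) ?mulr0 ?add0r ?mulr0 //; apply: contraNF ok => /eqP ->.
rewrite eqxx mulr1 -natr_n divfK ?natr_n_neq0 //.
under eq_bigr => j oj.
  rewrite (_ : k == j = false) ?mulr0 ?addr0 ?mulr1; last first.
    by apply: contraNF ok => /eqP ->.
  over.
by rewrite sum_odd; lra.
Qed.

End Coefficients.

Lemma gap_polytope_hull : gap_polytope = convex_hull vertices.
Proof.
apply/seteqP; split => [x Px|].
  rewrite -(vtx_weight_comb Px); apply: convex_set_sum.
  - exact: convex_hull_convex.
  - exact: vtx_weight_ge0.
  - by move=> p /(vtx_weight_gt0) Vp; exact: sub_convex_hull.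
  - exact: vtx_weight_sum.
by apply: convex_hull_min; [exact: gap_polytope_convex|exact: vertices_gap_polytope].
Qed.

Lemma convex_comb_tight (t a b c : R) : 0 < t < 1 -> a <= c -> b <= c ->
  c = t * a + (1 - t) * b -> a = c.
Proof.
move=> /andP[t0 t1] ac bc e; apply/eqP; rewrite eq_le ac /=.
have : 0 <= t * (a - c).
  have -> : t * (a - c) = (1 - t) * (c - b) by lra.
  by apply: mulr_ge0; lra.
by rewrite pmulr_rge0 // subr_ge0.
Qed.

(** Every inequality tight at the vertex is tight at [y]. So the gaps of [y] outside i and j vanish;
    for odd j the alternating inequality then fixes gap j at n - 1, and the total n fixes gap i. *)
Lemma vtx_comb_eq (i j : 'I_n) y z (t : R) : ~~ odd i -> odd j || (j == i) ->
  gap_polytope y -> gap_polytope z -> 0 < t < 1 ->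
  vtx i j = t *: y + (1 - t) *: z -> y = vtx i j.
Proof.
move=> ei oj [y0 yo] [z0 zo] t01 e.
have gy0 (k : 'I_n) : k != i -> k != j -> gap y k = 0.
  (* [convex_comb_tight] speaks of upper bounds, hence the change of sign. *)
  move=> ki kj; apply: oppr_inj; rewrite oppr0.
  apply: (@convex_comb_tight t _ (- gap z k)) => //; rewrite ?oppr_le0 //.
  have := congr1 (fun x => gap x k) e.
  by rewrite gap_comb // gap_vtx (negbTE ki) (negbTE kj) mulr0 addr0 !mulrN => e0; rewrite -opprD -e0 oppr0.
have gyn : i != j -> gap y i + gap y j = n%:R.
  move=> ij; rewrite -(sum_gap n_gt0 y) (bigD1 i) // (bigD1 j) 1?eq_sym //=.
  by rewrite big1 ?addr0 // => k /andP[]; exact: gy0.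
have [ji|ji] := eqVneq j i.
  subst j; apply: (gap_inj n_gt0) => k' klt; rewrite -[k']/(Ordinal klt : nat).
  have [->|ki] := eqVneq (Ordinal klt) i; last first.
    by rewrite gy0 // gap_vtx (negbTE ki) mulr0 addr0.
  rewrite gap_vtx eqxx mulr1 -natr_n -(sum_gap n_gt0 y) (bigD1 i) //= big1 ?addr0 //.
  by move=> k ki; rewrite gy0.
rewrite (negbTE ji) orbF in oj.
have gj (u : 'rV[R]_n.-1) : odd_gap u = gap u j + \sum_(k < n | odd k && (k != j)) gap u k.
  by rewrite /odd_gap (bigD1 j).
have gyj : gap y j = n.-1%:R.
  have : odd_gap y = n.-1%:R.
    apply: (@convex_comb_tight t _ (odd_gap z)) => //.
    have := congr1 (slack (alt_ineq R n)) e; rewrite slack_comb !slack_alt //.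
    by rewrite odd_gap_vtx // oj mulr1; lra.
  rewrite gj big1 ?addr0 // => k /andP[ok kj]; apply: gy0 => //.
  by apply: contraTneq ok => ->.
have ij : i != j by rewrite eq_sym.
have gyi : gap y i = 1 by have := gyn ij; rewrite gyj natr_n; lra.
apply: (gap_inj n_gt0) => k' klt; rewrite -[k']/(Ordinal klt : nat) gap_vtx.
case: (eqVneq (Ordinal klt) i) => [->|ki]; first by rewrite (negbTE ij) gyi mulr0 addr0.
case: (eqVneq (Ordinal klt) j) => [->|kj]; first by rewrite gyj mulr1 add0r.
by rewrite gy0 // mulr0 addr0.
Qed.

Lemma extreme_points_gap_polytope : extreme_points gap_polytope = vertices.
Proof.
apply/seteqP; split => [x|x Vx].
  by rewrite gap_polytope_hull; exact: extreme_points_convex_hull.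
split => [|y z t Py Pz t01]; first exact: vertices_gap_polytope.
case: Vx => i [j [ei oj ->]] e; split; first exact: vtx_comb_eq e.
apply: (vtx_comb_eq (z := y) (t := 1 - t) ei oj Pz Py).
  by case/andP: t01 => t0 t1; rewrite subr_gt0 t1 /= gtrBl.
by rewrite e subKr addrC.
Qed.

End Vertices.
Arguments vertices : clear implicits.
Arguments gap_polytope : clear implicits.

(** * Facets of the gap polytope *)

Section AffineIndependence.
Variables (R : realType) (n : nat).
Hypothesis n_gt0 : (0 < n)%N.
Implicit Types (f g : ineq R n.-1).

(** Gaps are slacks, so [slack_sum] turns an affine dependency of the points into a linear
    dependency of their gap vectors. *)
Lemma affinely_independent_gaps k (v : 'I_k -> 'rV[R]_n.-1) :
  (forall c : 'I_k -> R, (forall i : 'I_n, \sum_a c a * gap (v a) i = 0) ->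
     forall a, c a = 0) ->
  affinely_independent v.
Proof.
move=> H c sc scv; apply: H => i.
under eq_bigr do rewrite -(slack_chain n_gt0).
rewrite slack_sum scv sc mul0r sub0r /dotprod big1 ?oppr0 // => j _.
by rewrite [X in _ * X]mxE mulr0.
Qed.

(** A linear dependency of the gap vectors passes to tail sums, that is, to every x_j; at j = 0,
    where x_0 = n, it says that the coefficients sum to 0. *)
Lemma affinely_independent_row_free k (v : 'I_k -> 'rV[R]_n.-1) :
  affinely_independent v -> row_free (\matrix_(a < k, i < n) gap (v a) i).
Proof.
move=> av; apply: inj_row_free => c cM0.
have cg (i : 'I_n) : \sum_a c 0 a * gap (v a) i = 0.
  have := congr1 (fun A : 'rV_n => A 0 i) cM0; rewrite !mxE => cMi.
  by rewrite -[RHS]cMi; apply: eq_bigr => a _; rewrite mxE.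
have ctail (j : nat) : (j <= n)%N -> \sum_a c 0 a * xcoord (v a) j = 0.
  move=> jn; under eq_bigr do rewrite -sum_gap_tail // mulr_sumr.
  by rewrite exchange_big /= big1 // => i _; exact: cg.
apply/rowP => a; rewrite mxE; apply: av a.
  have := ctail 0%N isT; rewrite /xcoord /= -mulr_suml => /eqP.
  by rewrite mulf_eq0 (negbTE (natr_n_neq0 R n_gt0)) orbF => /eqP.
apply/rowP => j; rewrite summxE mxE -[RHS](ctail j.+1).
  by apply: eq_bigr => a _; rewrite mxE xcoordS.
by have := ltn_ord j; lia.
Qed.

(** The columns in [P] vanish off the diagonal, which kills the coefficients of their rows; the
    other columns are diagonal on the rows that remain. *)
Lemma affinely_independent_triangular k (v : 'I_k -> 'rV[R]_n.-1)
    (h : 'I_k -> 'I_n) (P : pred 'I_n) :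
  (forall a, gap (v a) (h a) != 0) ->
  (forall a b, a != b -> P (h b) || ~~ P (h a) -> gap (v a) (h b) = 0) ->
  affinely_independent v.
Proof.
move=> diag off; apply: affinely_independent_gaps => c cg.
have pick b : (forall a, a != b -> c a * gap (v a) (h b) = 0) -> c b = 0.
  move=> H; have := cg (h b); rewrite (bigD1 b) //= big1 ?addr0 //.
  by move/eqP; rewrite mulf_eq0 (negbTE (diag b)) orbF => /eqP.
have cP b : P (h b) -> c b = 0.
  by move=> Pb; apply: pick => a ab; rewrite off ?Pb // mulr0.
move=> b; have [/cP //|nPb] := boolP (P (h b)); apply: pick => a ab.
have [/cP ->|nPa] := boolP (P (h a)); first by rewrite mul0r.
by rewrite off ?nPa ?orbT // mulr0.
Qed.

Lemma affinely_independent_card k (v : 'I_k -> 'rV[R]_n.-1) :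
  affinely_independent v -> (k <= n)%N.
Proof.
move=> /affinely_independent_row_free; rewrite /row_free => /eqP <-.
exact: rank_leq_col.
Qed.

Lemma gap_mx_mul k (v : 'I_k -> 'rV[R]_n.-1) f :
  (forall a, slack f (v a) = 0) ->
  (\matrix_(a < k, i < n) gap (v a) i) *m (\col_(i < n) gap_coef f i) = 0.
Proof.
move=> sf; apply/colP => a; rewrite !mxE -[RHS](sf a) slack_gap //.
by apply: eq_bigr => i _; rewrite !mxE mulrC.
Qed.

Lemma gap_col_eq0 f : (\col_(i < n) gap_coef f i == 0) = (f == (0, 0)).
Proof.
have g0 i : gap_coef ((0, 0) : ineq R n.-1) i = 0.
  by rewrite /gap_coef mul0r sub0r big1 ?oppr0 // => j _; rewrite mxE.
apply/eqP/eqP => [/colP f0|->]; last by apply/colP => i; rewrite !mxE g0.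
by apply: (gap_coef_inj n_gt0) => i; have := f0 i; rewrite !mxE g0.
Qed.

(** The nonzero coefficient vector of [f] lies in the kernel of the gap matrix, whose rank is
    [k]. *)
Lemma affinely_independent_face_card k (v : 'I_k -> 'rV[R]_n.-1) f :
  affinely_independent v -> (forall a, slack f (v a) = 0) -> f != (0, 0) ->
  (k < n)%N.
Proof.
move=> /affinely_independent_row_free; rewrite /row_free => /eqP rM.
move=> /gap_mx_mul /mulmx0_rank_max; rewrite rM -gap_col_eq0 -mxrank_eq0 -lt0n.
lia.
Qed.

(** The linear forms in the gaps that vanish at n - 1 independent points form a line, spanned by
    that of [g]. *)
Lemma tight_proportional k (v : 'I_k -> 'rV[R]_n.-1) f g : k.+1 = n ->
  affinely_independent v -> (forall a, slack f (v a) = 0) ->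
  (forall a, slack g (v a) = 0) -> g != (0, 0) ->
  exists c : R, f = (c *: g.1, c * g.2).
Proof.
move=> kn /affinely_independent_row_free; rewrite /row_free => /eqP rM.
set M := (\matrix_(_, _) _) in rM => /gap_mx_mul; rewrite -/M => Mf.
move=> /gap_mx_mul; rewrite -/M => Mg; rewrite -gap_col_eq0 => g0.
have K (h : ineq R n.-1) : M *m (\col_(i < n) gap_coef h i) = 0 ->
    ((\col_(i < n) gap_coef h i)^T <= kermx M^T)%MS.
  by move=> Mh; apply/sub_kermxP; rewrite -trmx_mul Mh trmx0.
have rg : \rank (\col_(i < n) gap_coef g i)^T = 1%N.
  by rewrite rank_rV -trmx0 (inj_eq (@trmx_inj _ _ _)) g0.
have rK : \rank (kermx M^T) = 1%N.
  by rewrite mxrank_ker mxrank_tr rM -kn subSnn.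
have := mxrank_leqif_eq (K g Mg); rewrite rg rK => -[_ /esym /eqmxP gK].
have := K f Mf; rewrite -gK => /sub_rVP [c cE]; exists c.
apply: (gap_coef_inj n_gt0) => i; rewrite gap_coefZ.
by have := congr1 (fun A : 'rV_n => A 0 i) cE; rewrite !mxE.
Qed.

End AffineIndependence.

(** * Valid inequalities and facets *)

Section Facets.
Variables (R : realType) (m : nat).
Local Notation n := m.+1.
Local Notation P := (gap_polytope R n).
Implicit Types (x y z : 'rV[R]_n.-1) (f g : ineq R n.-1).

Lemma affine_dim_inj (A : set 'rV[R]_m) d d' :
  affine_dim A d -> affine_dim A d' -> d = d'.
Proof.
move=> [[v [av Av]] Ub] [[v' [av' Av']] Ub'].
by apply/eqP; rewrite eqn_leq -ltnS (Ub' _ v) //= -ltnS (Ub _ v').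
Qed.

Lemma validE (A : set 'rV[R]_m) f : valid A f <-> (forall x, A x -> 0 <= slack f x).
Proof. by split => H x /H; rewrite subr_ge0. Qed.

Lemma faceE (A : set 'rV[R]_m) f : face A f = [set x | A x /\ slack f x = 0].
Proof.
apply/seteqP; split => x [Ax e]; split => //; first by rewrite /slack e subrr.
by move/eqP: e; rewrite subr_eq0 => /eqP.
Qed.

Lemma slack_listed_ge0 g x : listed_ineqs R n g -> P x -> 0 <= slack g x.
Proof.
move=> + [x0 xo] => -[[i _ <-]|->]; first by rewrite slack_chain.
by rewrite slack_alt // subr_ge0.
Qed.

(* Farkas multipliers, read off from the values of the slack at the vertices. *)
Lemma valid_conic f : valid P f ->
  exists (mu : R) (nu : 'I_n -> R), [/\ 0 <= mu, forall i, 0 <= nu i &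
    forall i : 'I_n, gap_coef f i = mu * gap_coef (alt_ineq R n) i + nu i].
Proof.
move=> /validE vf.
have sv (i j : 'I_n) : ~~ odd i -> odd j || (j == i) ->
    0 <= gap_coef f i + n.-1%:R * gap_coef f j.
  move=> ei oj; have := vf (vtx R n i j).
  rewrite slack_gap //; under eq_bigr do rewrite gap_vtx // mulrDr mulrCA.
  rewrite big_split -mulr_sumr /= (bigD1 i) //= eqxx mulr1 big1; last first.
    by move=> k ki; rewrite (negbTE ki) mulr0.
  rewrite addr0 (bigD1 j) //= eqxx mulr1 big1 ?addr0; last first.
    by move=> k kj; rewrite (negbTE kj) mulr0.
  by apply; apply: vertices_gap_polytope => //; exists i, j.
have s_even (i : 'I_n) : ~~ odd i -> 0 <= gap_coef f i.
  move=> ei; have := sv i i ei; rewrite eqxx orbT => /(_ isT).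
  by rewrite -{1}[gap_coef f i]mul1r -mulrDl -natr_n // pmulr_rge0.
(* If no odd coefficient is negative, all coefficients of [f] are nonnegative and serve as
   multipliers of the chain inequalities. *)
have [/existsP[j1 /andP[oj1 sj1]]|] :=
  boolP [exists j : 'I_n, odd j && (gap_coef f j < 0)]; last first.
  rewrite negb_exists => /forallP H; exists 0, (fun i => gap_coef f i).
  split => // i; last by rewrite mul0r add0r.
  have := H i; have := s_even i; case: odd => /=; first by rewrite -leNgt.
  by move=> /(_ isT).
pose s (j : 'I_n) := gap_coef f j.
case: (@Order.TotalTheory.arg_minP _ _ _ j1 (fun j : 'I_n => odd j) s oj1) => j oj minj.
have sj0 : s j < 0 by rewrite (le_lt_trans _ sj1) // minj.
have n0 := natr_n_neq0 R (ltn0Sn m).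
have altE (i : 'I_n) : - s j * n%:R * gap_coef (alt_ineq R n) i =
    s j * (if odd i then 1 else - n.-1%:R).
  rewrite gap_coef_alt // -mulrA mulrBr [n%:R * (_ / _)]mulrC divfK //.
  by case: odd; rewrite ?mulr1 ?mulr0 ?subr0 ?(natr_n R (ltn0Sn m)) /=; lra.
(* The alternating inequality has coefficients -1/n at odd and (n - 1)/n at even indices. This
   multiple leaves s i - s j at odd i, nonnegative by the choice of j, and s i + (n - 1) s j at even
   i, nonnegative by the value at the vertex of i and j. *)
exists (- s j * n%:R), (fun i => s i - (- s j * n%:R) * gap_coef (alt_ineq R n) i).
split => [|i|i]; last by rewrite addrC subrK.
  by rewrite mulr_ge0 // oppr_ge0 ltW.
rewrite altE; have := minj i; have := sv i j; rewrite oj -/(s i) -/(s j).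
case: odd => /=; first by move=> _ /(_ isT); rewrite mulr1 subr_ge0.
by move=> /(_ isT isT) + _; lra.
Qed.

Lemma slack_conic f (mu : R) (nu : 'I_n -> R) x :
  (forall i : 'I_n, gap_coef f i = mu * gap_coef (alt_ineq R n) i + nu i) ->
  slack f x = mu * slack (alt_ineq R n) x + \sum_i nu i * gap x i.
Proof.
move=> fE; rewrite !slack_gap // mulr_sumr -big_split; apply: eq_bigr => i _ /=.
by rewrite fE mulrDl mulrA.
Qed.

(** Complementary slackness: where [f] is tight, so is each listed inequality with a nonzero
    multiplier, and a nonzero [f] has such a multiplier. *)
Lemma valid_sub_listed_face f : valid P f -> f != (0, 0) ->
  exists2 g, listed_ineqs R n g & face P f `<=` face P g.
Proof.
move=> /valid_conic[mu [nu [mu0 nu0 fE]]] f0.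
have key x : P x -> slack f x = 0 ->
    mu * slack (alt_ineq R n) x = 0 /\ forall i, nu i * gap x i = 0.
  move=> Px; rewrite (slack_conic x fE) => /eqP; case: (Px) => x0 _.
  have nug i : 0 <= nu i * gap x i by rewrite mulr_ge0.
  rewrite paddr_eq0; last 2 first.
  - by rewrite mulr_ge0 // slack_listed_ge0 //; right.
  - by rewrite sumr_ge0.
  case/andP => /eqP -> /eqP sg; split=> // i; apply/eqP.
  by have /psumr_eq0P /(_ sg) -> := (fun i (_ : true) => nug i).
have [mu_eq0|mu_neq0] := eqVneq mu 0; last first.
  exists (alt_ineq R n); first by right.
  rewrite !faceE => x [Px /(key x Px) [/eqP + _]].
  by rewrite mulf_eq0 (negbTE mu_neq0) /= => /eqP.
have [[i nui]|nui] := pselect (exists i, nu i != 0).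
  exists (chain_ineq R i); first by left; exists i.
  rewrite !faceE => x [Px /(key x Px) [_ /(_ i) /eqP gi]]; split => //.
  by move: gi; rewrite slack_chain // mulf_eq0 (negbTE nui) => /eqP.
case/negP: f0; rewrite -(gap_col_eq0 (ltn0Sn m)); apply/eqP/colP => i.
rewrite !mxE fE mu_eq0 mul0r add0r; apply: contrapT => /eqP ?; apply: nui.
by exists i.
Qed.

Lemma odd_neq_even (i j : 'I_n) : odd i -> ~~ odd j -> (i == j) = false.
Proof. by move=> oi; apply: contraNF => /eqP <-. Qed.

Lemma odd_pred_neq0 (i : 'I_n) : odd i -> n.-1%:R != 0 :> R.
Proof. by case: i => [[|i] ilt] //= _; rewrite pnatr_eq0; case: (m) ilt. Qed.

(** The points are n e_i for even i and e_q + (n - 1) e_j for odd j. An odd column meets only its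
    own row, and the even rows are diagonal. *)
Lemma vtx_affinely_independent k (h : 'I_k -> 'I_n) (q : 'I_n) :
  injective h -> ~~ odd q ->
  affinely_independent (fun a => vtx R n (if odd (h a) then q else h a) (h a)).
Proof.
move=> hI eq.
apply: (affinely_independent_triangular (ltn0Sn m) (h := h) (P := fun k => odd k)).
  move=> a; case: ifP => oa; rewrite gap_vtx // eqxx mulr1.
    by rewrite odd_neq_even // add0r (odd_pred_neq0 oa).
  by rewrite -natr_n // natr_n_neq0.
move=> a b ab; have hab : (h b == h a) = false.
  by rewrite (inj_eq hI) eq_sym (negbTE ab).
case: ifP => oa; rewrite gap_vtx // hab mulr0 addr0 //= orbF => ob.
by rewrite odd_neq_even.
Qed.

Lemma affine_dim_gap_polytope : affine_dim P m.
Proof.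
split; last by move=> k v av _; exact: (affinely_independent_card _ av).
exists (fun k : 'I_n => vtx R n (if odd k then ord0 : 'I_n else k) k); split.
  exact: (@vtx_affinely_independent _ id).
move=> k; apply: vertices_gap_polytope => //; exists (if odd k then ord0 else k), k.
by case: ifP => ok; split; rewrite ?ok ?eqxx.
Qed.

(** Here every second index is odd, so the points e_0 + (n - 1) e_j and e_i + (n - 1) e_r lie on the
    alternating face. Excluding index 0 makes each even column meet only its own row. *)
Lemma alt_vtx_affinely_independent k (h : 'I_k -> 'I_n) (r : 'I_n) :
  injective h -> (forall a, h a != ord0) -> odd r ->
  affinely_independent (fun a => vtx R n (if odd (h a) then ord0 : 'I_n else h a)
                                         (if odd (h a) then h a else r)).
Proof.
move=> hI h0 or.
apply: (affinely_independent_triangular (ltn0Sn m) (h := h) (P := fun k => ~~ odd k)).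
  move=> a; case: ifP => oa; rewrite gap_vtx // eqxx.
    by rewrite mulr1 odd_neq_even // add0r (odd_pred_neq0 oa).
  by rewrite (eq_sym _ r) odd_neq_even ?oa // mulr0 addr0 oner_eq0.
move=> a b ab; have hab : (h b == h a) = false.
  by rewrite (inj_eq hI) eq_sym (negbTE ab).
case: ifP => oa; rewrite gap_vtx // hab ?mulr0 ?addr0 ?add0r /= ?orbF => ob.
  by rewrite (negbTE (h0 b)).
by rewrite (eq_sym _ r) odd_neq_even // mulr0.
Qed.

Lemma listed_face_points g : ~~ odd m -> (0 < m)%N -> listed_ineqs R n g ->
  exists v : 'I_m -> 'rV[R]_m, affinely_independent v /\ forall a, face P g (v a).
Proof.
move=> em m0 [[i _ <-]|->].
  (* Dropping index i and pairing the odd indices with an even q other than i keeps gap i at 0; q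
     exists because n is at least 3. *)
  have [q eq qi] : exists2 q : 'I_n, ~~ odd q & q != i.
    have lt2 : (2 < n)%N by lia.
    have [->|] := eqVneq i ord0; first by exists (Ordinal lt2).
    by rewrite eq_sym; exists ord0.
  exists (fun a => vtx R n (if odd (lift i a) then q else lift i a) (lift i a)).
  split; first by apply: vtx_affinely_independent => //; exact: lift_inj.
  move=> a; rewrite faceE; split.
    apply: vertices_gap_polytope => //.
    exists (if odd (lift i a) then q else lift i a), (lift i a).
    by case: ifP => ok; split; rewrite ?ok ?eqxx.
  rewrite slack_chain // [LHS]gap_vtx // (negbTE (neq_lift i a)) mulr0 addr0.
  case: ifP => _; last by rewrite (negbTE (neq_lift i a)).
  by rewrite eq_sym (negbTE qi).
have lt1 : (1 < n)%N by lia.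
pose r := Ordinal lt1.
exists (fun a => vtx R n (if odd (lift ord0 a) then ord0 : 'I_n else lift ord0 a)
                         (if odd (lift ord0 a) then lift ord0 a else r)).
split.
  apply: alt_vtx_affinely_independent => [|a|//]; first exact: lift_inj.
  by rewrite eq_sym neq_lift.
move=> a; rewrite faceE; split.
  apply: vertices_gap_polytope => //.
  exists (if odd (lift ord0 a) then ord0 else lift ord0 a),
         (if odd (lift ord0 a) then lift ord0 a else r).
  by split => //; case: ifP => // ->.
rewrite slack_alt // odd_gap_vtx //; last by case: ifP => // ->.
have -> : odd (if odd (lift ord0 a) then lift ord0 a else r) by case: ifP.
by rewrite mulr1 subrr.
Qed.

Lemma listed_neq0 g : ~~ odd m -> (0 < m)%N -> listed_ineqs R n g -> g != (0, 0).
Proof.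
move=> em m0 lg; rewrite -(gap_col_eq0 (ltn0Sn m)); apply/eqP => /colP g0.
case: lg g0 => [[i _ <-]|->] g0.
  by have := g0 i; rewrite !mxE gap_coef_chain // eqxx => /eqP; rewrite oner_eq0.
have := g0 ord0; rewrite !mxE gap_coef_alt // subr0 => /eqP.
rewrite mulf_eq0 invr_eq0 (negbTE (natr_n_neq0 R (ltn0Sn m))) orbF pnatr_eq0.
by rewrite /= -(prednK m0).
Qed.

Lemma facet_defining_listed f : ~~ odd m -> (0 < m)%N ->
  facet_defining P f <-> exists2 g, listed_ineqs R n g & positive_multiple f g.
Proof.
move=> em m0; split.
  move=> [vf [d [dP dF]]].
  have md := affine_dim_inj affine_dim_gap_polytope dP.
  have proper : face P f = P -> False.
    by move=> E; rewrite E in dF; have := affine_dim_inj dP dF; lia.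
  have f0 : f != (0, 0).
    apply/eqP => f0; apply: proper; apply/seteqP; split => [x []//|x Px].
    split=> //; rewrite f0 /dotprod big1 // => j _.
    by rewrite mxE mul0r.
  have [g lg fg] := valid_sub_listed_face vf f0.
  case: dF => -[v [av Fv]] _; exists g => //.
  have [||||c cE] := tight_proportional (ltn0Sn m) (f := f) (g := g) _ av.
  - by rewrite md.
  - by move=> a; have := Fv a; rewrite faceE => -[].
  - by move=> a; have := fg _ (Fv a); rewrite faceE => -[].
  - exact: listed_neq0.
  (* If c <= 0, the slack of [f] is also nonpositive on the polytope, which is then its own face. *)
  exists c => //; rewrite ltNge; apply/negP => c0; apply: proper.
  rewrite faceE; apply/seteqP; split => [x []//|x Px]; split=> //.
  apply/eqP; rewrite eq_le; apply/andP; split; last by move/validE: vf; apply.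
  by rewrite cE slackZ mulr_le0_ge0 // slack_listed_ge0.
move=> [g lg [c c0 ->]]; split.
  by apply/validE => x Px; rewrite slackZ mulr_ge0 ?slack_listed_ge0 // ltW.
exists m.-1; rewrite prednK //; split; first exact: affine_dim_gap_polytope.
have -> : face P (c *: g.1, c * g.2) = face P g.
  rewrite !faceE; apply/seteqP; split=> x [Px] => [|sx]; last first.
    by split=> //; rewrite slackZ sx mulr0.
  by rewrite slackZ => /eqP; rewrite mulf_eq0 gt_eqF //= => /eqP.
split; first by rewrite prednK //; exact: listed_face_points.
move=> k v av Fv; rewrite prednK // -ltnS.
apply: (affinely_independent_face_card (ltn0Sn m) av (f := g)).
  by move=> a; have := Fv a; rewrite faceE => -[].
exact: listed_neq0.
Qed.

End Facets.

(** * Graphs realising the vertices *)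

Section Graphs.
Variables (R : realType) (n : nat).
Hypothesis n_gt0 : (0 < n)%N.
Implicit Types G : sgraph n.

Lemma degree_sum G i : degree G i = (\sum_j (edge G i j : nat))%N.
Proof.
rewrite /degree -sum1_card big_mkcond; apply: eq_bigr => j _.
by rewrite /in_mem /=; case: edge.
Qed.

Lemma degree_lt G i : (degree G i < n)%N.
Proof.
rewrite /degree -[X in (_ < X)%N]card_ord -cardsT; apply: proper_card.
rewrite properE; apply/andP; split; first by apply/fintype.subsetP => j; rewrite inE.
by apply/negP => /fintype.subsetP /(_ i); rewrite inE /in_mem /= edge_irr => /(_ isT).
Qed.

Lemma dual_degreeE G k : dual_degree G k = (\sum_i (k <= degree G i : nat))%N.
Proof.
rewrite /dual_degree /degree_partition count_sort count_map -sum1_count big_enum_cond /=.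
by rewrite big_mkcond; apply: eq_bigr => i _; case: leq.
Qed.

Lemma xcoord_dual_degree G k : (k <= n)%N ->
  xcoord (dual_degree_vector R G) k = \sum_i (k <= degree G i)%:R.
Proof.
rewrite leq_eqVlt => /predU1P[->|].
  rewrite xcoord_last // big1 // => i _.
  by rewrite leqNgt degree_lt.
case: k => [|k] klt.
  by rewrite /xcoord /= sumr_const card_ord.
have klt' : (k < n.-1)%N by lia.
by rewrite (xcoordS _ (Ordinal klt')) mxE dual_degreeE natr_sum.
Qed.

Lemma gap_dual_degree G (k : 'I_n) :
  gap (dual_degree_vector R G) k = \sum_i (degree G i == k)%:R.
Proof.
rewrite /gap !xcoord_dual_degree // ?(ltnW (ltn_ord k)) // -sumrB.
by apply: eq_bigr => i _; rewrite eq_sym; case: ltngtP; rewrite ?subrr ?subr0.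
Qed.

(** Handshake count: [s] counts the edges from their smaller end, and the exchanged sum counts them
    from the larger one. *)
Lemma sum_degree_even G : ~~ odd (\sum_i degree G i)%N.
Proof.
pose s := (\sum_(i < n) \sum_(j < n) ((i < j)%N && edge G i j : nat))%N.
have -> : (\sum_i degree G i = s + s)%N; last by rewrite addnn odd_double.
rewrite {2}/s exchange_big -big_split; apply: eq_bigr => i _.
rewrite degree_sum -big_split; apply: eq_bigr => j _ /=.
rewrite (edge_sym G j i); case: ltngtP => [_|_|/val_inj ->] /=; rewrite ?addn0 //.
by rewrite edge_irr.
Qed.

Lemma odd_degree_even G : ~~ odd (\sum_i (odd (degree G i) : nat))%N.
Proof.
have := sum_degree_even G; rewrite !(big_morph odd oddD (erefl _)).
by under [in X in _ -> X]eq_bigr do rewrite oddb.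
Qed.

Lemma dual_degree_gap_polytope G : odd n -> gap_polytope R n (dual_degree_vector R G).
Proof.
move=> on; split => [k|]; first by rewrite gap_dual_degree sumr_ge0.
have -> : odd_gap (dual_degree_vector R G) = (\sum_i (odd (degree G i) : nat))%N%:R.
  rewrite /odd_gap; under [LHS]eq_bigr do rewrite gap_dual_degree.
  rewrite exchange_big natr_sum; apply: eq_bigr => i _ /=.
  have lti := degree_lt G i.
  case: (boolP (odd (degree G i))) => oi.
    rewrite (bigD1 (Ordinal lti)) //= eqxx big1 ?addr0 // => k /andP[_].
    by rewrite -val_eqE eq_sym /= => /negbTE ->.
  rewrite big1 // => k ok; case: eqP => // e.
  by rewrite e ok in oi.
have le : (\sum_(i < n) (odd (degree G i) : nat) <= n)%N.
  rewrite -[X in (_ <= X)%N]card_ord -sum1_card; apply: leq_sum => i _.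
  exact: leq_b1.
(* Not all n vertices have odd degree: n is odd and the number of such vertices is even. *)
rewrite ler_nat -ltnS prednK // ltn_neqAle le andbT.
by apply: contraNneq (odd_degree_even G) => ->.
Qed.

Lemma dual_degree_vtx G (i j : nat) (v0 : 'I_n) :
  degree G v0 = i -> (forall v, v != v0 -> degree G v = j) ->
  dual_degree_vector R G = vtx R n i j.
Proof.
move=> d0 d; apply/rowP => k; rewrite !mxE dual_degreeE natr_sum (bigD1 v0) //= d0.
congr (_ + _); rewrite (eq_bigr (fun=> (k < j)%:R)) => [|v /d -> //].
by rewrite sumr_const cardC1 card_ord mulr_natl.
Qed.

End Graphs.

(** * Circulant graphs and their extension by one vertex *)

Section Circulants.
Variable m : nat.
Local Notation C := 'I_m.+1.

Lemma sum_translate (a : C) (F : C -> nat) : (\sum_b F (b - a)%R = \sum_d F d)%N.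
Proof.
rewrite (reindex_inj (addIr a)); apply: eq_bigr => d _.
by rewrite addrK.
Qed.

Lemma card_sum (S : {set C}) : #|S| = (\sum_d (d \in S : nat))%N.
Proof. by rewrite -sum1_card big_mkcond; apply: eq_bigr => d _; case: in_mem. Qed.

(** The set consists of 1, ..., k and their negatives modulo m + 1. The bounds on its elements keep
    the next pair new, and in [apex_graph] they exclude the antipode [h]. *)
Lemma symmetric_set k : (k.*2 <= m)%N -> exists S : {set C},
  [/\ 0 \notin S, forall d, d \in S -> - d \in S, #|S| = k.*2 &
      forall d : C, d \in S -> (d <= k)%N || (m.+1 - k <= d)%N].
Proof.
elim: k => [|k IH] km.
  by exists finset.set0; split => [|d||d]; rewrite ?inE ?cards0.
have [|S [S0 SN cS Sb]] := IH; first by lia.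
have lt1 : (k.+1 < m.+1)%N by lia.
pose d1 : C := Ordinal lt1.
have vN : - d1 = (m - k)%N :> nat by rewrite /= modn_small; lia.
have vN' : val (- d1) = (m - k)%N := vN.
exists (d1 |: (- d1 |: S)); split.
- rewrite !inE !negb_or S0 -!val_eqE andbT; apply/andP; split => //.
  by rewrite vN' /=; lia.
- move=> d; rewrite !inE => /or3P[/eqP ->|/eqP ->|/SN ->]; rewrite ?eqxx ?orbT //.
  by rewrite opprK eqxx.
- rewrite !cardsU1 cS !inE -!val_eqE vN'.
  have -> : (d1 \in S) = false.
    by apply/negP => /Sb /=; lia.
  have -> : (- d1 \in S) = false.
    by apply/negP => /Sb; rewrite vN; lia.
  rewrite orbF (_ : (val d1 == (m - k)%N) = false) /=; lia.
- move=> d; rewrite !inE => /or3P[/eqP ->|/eqP ->|/Sb].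
  + by rewrite leqnn.
  + by rewrite vN; lia.
  + lia.
Qed.

(** The Cayley graph of Z/(m + 1), carried by ['I_m.+1], on that symmetric set. *)
Lemma circulant_graph k : (k.*2 <= m)%N ->
  exists G : sgraph m.+1, forall v, degree G v = k.*2.
Proof.
move=> /symmetric_set [S [S0 SN cS _]].
have esym : symmetric (fun a b : C => b - a \in S).
  by move=> a b; apply/idP/idP => /SN; rewrite opprB.
have eirr : irreflexive (fun a b : C => b - a \in S).
  by move=> a; rewrite subrr (negbTE S0).
exists (SGraph esym eirr) => v.
by rewrite degree_sum /= (sum_translate v (fun d => d \in S)) -card_sum.
Qed.

Variable p : nat.
Hypothesis mp : m.+1 = p.*2.

Lemma half_lt : (p < m.+1)%N. Proof. by lia. Qed.

Let h : C := Ordinal half_lt.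

Lemma half_opp : - h = h.
Proof. by apply: val_inj; rewrite /= mp -addnn addnK modn_small; lia. Qed.

(** The union of the pairs x, x + p for x < t; the bounds keep the next pair new. *)
Lemma antipodal_set t : (t <= p)%N -> exists T : {set C},
  [/\ forall x, x \in T -> x + h \in T, #|T| = t.*2 &
      forall x : C, x \in T -> (x < t)%N || (p <= x < p + t)%N].
Proof.
elim: t => [|t IH] tp.
  by exists finset.set0; split => [d||d]; rewrite ?inE ?cards0.
have [|T [Th cT Tb]] := IH; first by lia.
have lt1 : (t < m.+1)%N by lia.
pose x1 : C := Ordinal lt1.
have vh : x1 + h = (t + p)%N :> nat by rewrite /= modn_small; lia.
have vh' : val (x1 + h) = (t + p)%N := vh.
exists (x1 |: (x1 + h |: T)); split.
- move=> d; rewrite !inE => /or3P[/eqP ->|/eqP ->|/Th ->]; rewrite ?eqxx ?orbT //.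
  by rewrite -addrA -{2}half_opp subrr addr0 eqxx.
- rewrite !cardsU1 cT !inE -!val_eqE vh'.
  have -> : (x1 \in T) = false.
    by apply/negP => /Tb /=; lia.
  have -> : (x1 + h \in T) = false.
    by apply/negP => /Tb; rewrite vh; lia.
  rewrite orbF (_ : (val x1 == (t + p)%N) = false) /=; lia.
- move=> d; rewrite !inE => /or3P[/eqP ->|/eqP ->|/Tb].
  + by rewrite /= ltnSn.
  + by rewrite vh; lia.
  + lia.
Qed.

(* A regular circulant graph of odd degree on an even cycle, in which some
   antipodal edges are removed and their ends joined to the new vertex 0. *)
Definition apex_edge (S T : {set C}) (x y : 'I_m.+2) : bool :=
  match unlift ord0 x, unlift ord0 y with
  | None, None => false
  | None, Some b => b \in T
  | Some a, None => a \in T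
  | Some a, Some b => (b - a \in S) && ~~ ((b - a == h) && (a \in T))
  end.

(** An old vertex starts with 2k + 1 circulant neighbours, its antipode among them. Members of [T]
    trade the antipode for the new vertex, whose degree is therefore the size of [T]. *)
Lemma apex_graph t k : (t <= p)%N -> (k < p)%N ->
  exists G : sgraph m.+2, degree G ord0 = t.*2 /\
    forall v, v != ord0 -> degree G v = k.*2.+1.
Proof.
move=> tp kp; have [T [Th cT _]] := antipodal_set tp.
have [|S' [S0' SN' cS' Sb']] := @symmetric_set k; first by lia.
have hS' : h \notin S' by apply/negP => /Sb' /=; lia.
pose S := h |: S'.
have S0 : 0 \notin S.
  rewrite !inE negb_or S0' andbT -val_eqE /=; lia.
have SN d : d \in S -> - d \in S.
  by rewrite !inE => /orP[/eqP ->|/SN' ->]; rewrite ?half_opp ?eqxx ?orbT.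
have cS : #|S| = k.*2.+1 by rewrite cardsU1 hS' cS'.
have SNE (a b : C) : (b - a \in S) = (a - b \in S).
  by apply/idP/idP => /SN; rewrite opprB.
have hE (a b : C) : (b - a == h) = (a - b == h).
  by rewrite -(inj_eq oppr_inj) opprB half_opp.
have esym : symmetric (apex_edge S T).
  move=> x y; rewrite /apex_edge; case: unliftP => [a _|_]; case: unliftP => [b _|_] //.
  (* Removing antipodal edges is symmetric because [T] is closed under adding [h]. *)
  rewrite SNE hE; congr (_ && ~~ _); case: eqP => //= ab.
  have e1 : a = b + h by rewrite -ab addrC subrK.
  have e2 : b = a + h by rewrite e1 -addrA -{2}half_opp subrr addr0.
  by apply/idP/idP => /Th; rewrite -?e1 -?e2.
have eirr : irreflexive (apex_edge S T).
  move=> x; rewrite /apex_edge; case: unliftP => // a _.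
  by rewrite subrr (negbTE S0).
exists (SGraph esym eirr); split.
  rewrite degree_sum big_ord_recl /= {1}/apex_edge unlift_none add0n -cT card_sum.
  by apply: eq_bigr => b _; rewrite /apex_edge unlift_none liftK.
move=> v; case: (unliftP ord0 v) => [a ->|->] // _.
rewrite degree_sum big_ord_recl /= {1}/apex_edge unlift_none liftK.
under eq_bigr do rewrite /apex_edge !liftK.
rewrite (sum_translate a (fun d => (d \in S) && ~~ ((d == h) && (a \in T)))).
have [aT|aT] := boolP (a \in T); last first.
  by rewrite add0n -cS card_sum; apply: eq_bigr => d _; rewrite andbF andbT.
rewrite -cS (cardsD1 h S) setU11 card_sum; congr (_ + _)%N.
by apply: eq_bigr => d _; rewrite !inE andbT andbC.
Qed.

End Circulants.

(** The point n e_i asks for a regular graph of even degree i, and e_i + (n - 1) e_j for one vertex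
    of even degree i among vertices of odd degree j: the new vertex of [apex_graph] over the other n
    - 1. *)
Lemma vertices_dual_degree (R : realType) n : odd n ->
  vertices R n `<=` range (@dual_degree_vector R n).
Proof.
move=> on _ [i [j [ei oj ->]]]; case: n on i j ei oj => // m em i j ei oj.
have iE : i = i./2.*2 :> nat by rewrite -[LHS]odd_double_half (negbTE ei).
have [ji|ji] := eqVneq j i.
  have [|G dG] := @circulant_graph m i./2; first by rewrite -iE -ltnS.
  exists G => //; apply: (dual_degree_vtx R (v0 := i)) => [|v _]; rewrite dG ?ji //.
rewrite (negbTE ji) orbF in oj.
(* For n = 1 there is no odd index; otherwise n - 1 is positive and even, as antipodes require. *)
case: m em i j ei oj iE ji => [|m] em i j ei oj iE ji.
  by case: j oj {ji} => -[].
have jE : j = j./2.*2.+1 :> nat by rewrite -[LHS]odd_double_half oj.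
have mp : m.+1 = (m.+1)./2.*2.
  by rewrite -[LHS]odd_double_half; move: em; rewrite /= => /negbTE ->.
have := ltn_ord i; have := ltn_ord j => ltj lti.
have [||G [d0 d]] := @apex_graph m _ mp i./2 j./2; try by lia.
exists G => //; apply: (dual_degree_vtx R (v0 := ord0)); first by rewrite d0.
by move=> v /d ->.
Qed.

Lemma dual_degree_polytopeE (R : realType) n : odd n ->
  dual_degree_polytope R n = gap_polytope R n.
Proof.
move=> on; have n_gt0 := odd_gt0 on.
apply/seteqP; split.
  apply: convex_hull_min; first exact: gap_polytope_convex.
  by move=> _ [G _ <-]; exact: dual_degree_gap_polytope.
rewrite gap_polytope_hull //; apply: convex_hull_min; first exact: convex_hull_convex.
by move=> x /(vertices_dual_degree on) ?; exact: sub_convex_hull.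
Qed.

(** * Counting the vertices *)

Lemma card_image_finset (T : finType) (U : Type) (f : T -> U) (A : {set T}) :
  injective f -> f @` [set x | x \in A] #= `I_#|A|.
Proof.
move=> fI; apply: (card_eq_trans (inj_card_eq (in2W fI))).
rewrite card_eq_sym; apply: (card_eq_trans card_II).
have -> : [set x | x \in A] = enum_val @` [set: 'I_#|A|].
  apply/seteqP; split => [x xA|_ [k _ <-]]; last exact: enum_valP.
  by exists (enum_rank_in xA x) => //; rewrite enum_rankK_in.
by rewrite card_eq_sym; apply: inj_card_eq; exact: in2W enum_val_inj.
Qed.

Section Counting.
Variables (R : realType) (p : nat).
Local Notation n := p.*2.+1.

(** Gap i is positive on the left and, i being even, vanishes on the right unless i = i'. An odd
    second index is then seen as the nonzero odd gap. *)
Lemma vtx_inj (i j i' j' : 'I_n) :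
  ~~ odd i -> odd j || (j == i) -> ~~ odd i' -> odd j' || (j' == i') ->
  vtx R n i j = vtx R n i' j' -> i = i' /\ j = j'.
Proof.
move=> ei oj ei' oj' E.
have g (k : 'I_n) : (k == i)%:R + n.-1%:R * (k == j)%:R =
    (k == i')%:R + n.-1%:R * (k == j')%:R :> R.
  by rewrite -!gap_vtx // E.
have ii : i = i'.
  apply/eqP; apply: contraT => ii'; have := g i; rewrite eqxx (negbTE ii') add0r.
  have -> : i == j' = false.
    case/orP: oj' => [oj'|/eqP -> //]; last by rewrite (negbTE ii').
    by apply: contraNF ei => /eqP ->.
  by move=> /eqP; rewrite mulr0 gt_eqF // ltr_pwDl // mulr_ge0.
split => //; subst i'.
have odd_case (a b : 'I_n) : odd a ->
    (a == i)%:R + n.-1%:R * (a == a)%:R = (a == i)%:R + n.-1%:R * (a == b)%:R :> R ->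
    a = b.
  move=> oa /addrI; rewrite eqxx mulr1; case: eqP => // _ /eqP.
  by rewrite mulr0 (negbTE (odd_pred_neq0 R oa)).
have [oj1|ej] := boolP (odd j); first by apply: odd_case (g j).
have [oj1|ej'] := boolP (odd j'); first by apply/esym; apply: odd_case (esym (g j')).
by move: oj oj'; rewrite (negbTE ej) (negbTE ej') /= => /eqP -> /eqP ->.
Qed.

Lemma double_lt (i : 'I_p.+1) : (i.*2 < n)%N.
Proof. by have := ltn_ord i; lia. Qed.

Lemma doubleS_lt (j : 'I_p) : (j.*2.+1 < n)%N.
Proof. by have := ltn_ord j; lia. Qed.

(** [None] encodes a second index equal to the first, so that each vertex has exactly one code. *)
Definition vtx_of (q : 'I_p.+1 * option 'I_p) : 'rV[R]_n.-1 :=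
  vtx R n q.1.*2 (if q.2 is Some j then j.*2.+1 else q.1.*2).

Lemma vtx_of_inj : injective vtx_of.
Proof.
move=> [i j] [i' j'] /=.
pose e (i : 'I_p.+1) := Ordinal (double_lt i).
pose o (i : 'I_p.+1) (j : option 'I_p) : 'I_n :=
  if j is Some j then Ordinal (doubleS_lt j) else e i.
have oE a b : vtx_of (a, b) = vtx R n (e a) (o a b) by rewrite /vtx_of; case: b.
have ee a : ~~ odd (e a) by rewrite /= odd_double.
have oo a b : odd (o a b) || (o a b == e a).
  by case: b => [b|] /=; rewrite ?odd_double ?eqxx ?orbT.
rewrite !oE => /(vtx_inj (ee i) (oo i j) (ee i') (oo i' j')) [].
move=> /(congr1 val) /= /double_inj /val_inj <-.
case: j j' => [j|] [j'|] //= /(congr1 val) /=.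
- by move=> [/double_inj /val_inj ->].
- by move=> /(congr1 odd); rewrite /= !odd_double.
- by move=> /(congr1 odd); rewrite /= !odd_double.
Qed.

Lemma point_aE k : point_a R n k = vtx R n k.*2 k.*2.
Proof.
apply/rowP => j; rewrite !mxE mul2n; case: ifP => _.
  by rewrite mulr1 natr_n.
by rewrite mulr0 addr0.
Qed.

Lemma point_bE k l : point_b R n k l = vtx R n k.*2 (k + l).*2.+1.
Proof.
apply/rowP => j; rewrite !mxE.
have -> : (j < k.*2)%N = (j < 2 * k)%N by lia.
have -> : (j < (k + l).*2.+1)%N = (j < 2 * k + (2 * l + 1))%N by lia.
case: ifP => jk; last by case: ifP; rewrite ?mulr0 ?mulr1 add0r.
rewrite (_ : (j < 2 * k + _)%N = true); last by lia.
by rewrite mulr1 natr_n.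
Qed.

Lemma point_cE k l : point_c R n k l = vtx R n (k + l).+1.*2 k.*2.+1.
Proof.
apply/rowP => j; rewrite !mxE.
have -> : (j < k.*2.+1)%N = (j < 2 * k + 1)%N by lia.
have -> : (j < (k + l).+1.*2)%N = (j < 2 * k + 1 + (2 * l + 1))%N by lia.
case: ifP => jk; last by case: ifP; rewrite ?mulr0 ?addr0.
rewrite (_ : (j < 2 * k + 1 + _)%N = true); last by lia.
by rewrite mulr1 natr_n.
Qed.

Definition a_index : {set 'I_p.+1 * option 'I_p} := [set q | q.2 == None]%SET.

(** The even index 2i lies below the odd index 2j + 1 exactly when i <= j; the order of the two
    indices separates the points b from the points c. *)
Definition b_index : {set 'I_p.+1 * option 'I_p} :=
  [set q : 'I_p.+1 * option 'I_p | if q.2 is Some j then q.1 <= j else false]%N%SET.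

Definition c_index : {set 'I_p.+1 * option 'I_p} :=
  [set q : 'I_p.+1 * option 'I_p | if q.2 is Some j then j < q.1 else false]%N%SET.

Lemma points_aE : points_a R n = vtx_of @` [set q | q \in a_index].
Proof.
apply/seteqP; split => [_ [k kn ->]|x [[i [j|]]]]; rewrite /= ?inE //=.
  have klt : (k < p.+1)%N by lia.
  by exists (Ordinal klt, None); rewrite ?inE // point_aE.
by move=> _ <-; exists i; [have := ltn_ord i; lia|rewrite point_aE].
Qed.

Lemma points_bE : points_b R n = vtx_of @` [set q | q \in b_index].
Proof.
apply/seteqP; split => [_ [k [l [kl ->]]]|x [[i [j|]]]]; rewrite /= ?inE //=.
  have klt : (k < p.+1)%N by lia.
  have jlt : (k + l < p)%N by lia.
  by exists (Ordinal klt, Some (Ordinal jlt)); rewrite ?inE /= ?leq_addr // point_bE.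
move=> ij <-; exists i, (j - i)%N; split; first by have := ltn_ord j; lia.
by rewrite point_bE subnKC.
Qed.

Lemma points_cE : points_c R n = vtx_of @` [set q | q \in c_index].
Proof.
apply/seteqP; split => [_ [k [l [kl ->]]]|x [[i [j|]]]]; rewrite /= ?inE //=.
  have ilt : ((k + l).+1 < p.+1)%N by lia.
  have jlt : (k < p)%N by lia.
  exists (Ordinal ilt, Some (Ordinal jlt)); rewrite ?inE /= ?ltnS ?leq_addr //.
  by rewrite point_cE.
move=> ij <-; exists j, (i - j.+1)%N; split; first by have := ltn_ord i; lia.
by rewrite point_cE -addSn subnKC.
Qed.

Lemma verticesE : vertices R n = vtx_of @` setT.
Proof.
apply/seteqP; split => [_ [i [j [ei oj ->]]]|_ [[i j] _ <-]].
  have ip : (i./2 < p.+1)%N by have := ltn_ord i; lia.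
  have iE : i = i./2.*2 :> nat by rewrite -[LHS]odd_double_half (negbTE ei).
  have [oj'|ej] := boolP (odd j).
    have jp : (j./2 < p)%N by have := ltn_ord j; lia.
    exists (Ordinal ip, Some (Ordinal jp)) => //; rewrite /vtx_of /= -iE.
    by rewrite -[in RHS](odd_double_half j) oj'.
  exists (Ordinal ip, None) => //; rewrite /vtx_of /= -iE.
  by move: oj; rewrite (negbTE ej) => /eqP ->.
case: j => [j|].
  by exists (Ordinal (double_lt i)), (Ordinal (doubleS_lt j)); rewrite /= !odd_double.
by exists (Ordinal (double_lt i)), (Ordinal (double_lt i)); rewrite /= odd_double eqxx orbT.
Qed.

Lemma vertices_points :
  vertices R n = points_a R n `|` points_b R n `|` points_c R n.
Proof.
rewrite verticesE points_aE points_bE points_cE -!image_setU; congr (_ @` _).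
apply/seteqP; split => // -[i [j|]] _; last by left; left; rewrite /= inE.
have [ij|ij] := leqP i j; first by left; right; rewrite /= inE.
by right; rewrite /= inE.
Qed.

Lemma card_index_sum (F : 'I_p.+1 -> option 'I_p -> bool) :
  #|[set q : 'I_p.+1 * option 'I_p | F q.1 q.2]%SET| =
  (\sum_i (F i None + \sum_j F i (Some j)))%N.
Proof.
rewrite -sum1_card big_mkcond.
rewrite (eq_bigr (fun q => (F q.1 q.2 : nat))); last first.
  by move=> q _; rewrite inE; case: F.
rewrite -(pair_bigA _ (fun i j => (F i j : nat))); apply: eq_bigr => i _ /=.
rewrite (bigD1 None) //=; congr (_ + _)%N.
rewrite (reindex_omap Some id) => [|[]//]; apply: eq_bigl => j.
by rewrite eqxx.
Qed.

Lemma card_a_index : #|a_index| = p.+1.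
Proof.
rewrite (card_index_sum (fun _ o => o == None)).
under eq_bigr do rewrite eqxx big1 //.
by rewrite sum1_card card_ord.
Qed.

Lemma card_c_index : #|c_index| = 'C(p.+1, 2).
Proof.
rewrite (card_index_sum (fun i o => if o is Some j then j < i else false)%N).
rewrite -bin2_sum big_mkord; apply: eq_bigr => i _; rewrite add0n.
have ip : (i <= p)%N by rewrite -ltnS.
have := @big_ord_widen _ 0%N addn i p (fun=> 1%N) ip.
rewrite sum1_card card_ord big_mkcond => iE; rewrite [RHS]iE.
by apply: eq_bigr => j _; case: ltnP.
Qed.

(** The codes of b and c together number (p + 1)^2 - (p + 1), twice the binomial coefficient, and
    those of c make up half. *)
Lemma card_b_index : #|b_index| = 'C(p.+1, 2).
Proof.
apply: (@addIn #|c_index|); rewrite [in RHS]card_c_index addnn.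
transitivity #|~: a_index|.
  rewrite -cardsUI (_ : b_index :&: c_index = finset.set0)%SET ?cards0 ?addn0.
    congr #|pred_of_set _|; apply/setP => -[i [j|]]; rewrite !inE //=.
    by case: leqP.
  by apply/setP => -[i [j|]]; rewrite !inE //=; case: leqP.
rewrite cardsCs finset.setCK card_a_index card_prod card_option !card_ord.
by have := mul_bin_diag p.+1 1; rewrite bin1 /=; lia.
Qed.

End Counting.

Lemma odd_gap_half (R : realType) p (x : 'rV[R]_(p.*2)) :
  odd_gap (n := p.*2.+1) x =
  \sum_(k < p) (xcoord (n := p.*2.+1) x (2 * k + 1) - xcoord (n := p.*2.+1) x (2 * k + 2)).
Proof.
rewrite /odd_gap; set F := gap (n := p.*2.+1) x.
rewrite (eq_bigr (fun k : 'I_p => F k.*2.+1)); last first.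
  by move=> k _; rewrite /F /gap mul2n addn1 addn2.
(* Each induction step adds the indices 2q + 1 and 2q + 2, of which only the first contributes. *)
rewrite big_mkcond; elim: (p) => [|q IH]; first by rewrite big_ord_recl /= !big_ord0 addr0.
by rewrite doubleS 2!big_ord_recr [in RHS]big_ord_recr /= IH /= odd_double /= addr0.
Qed.

(** For n = 1 the polytope is a single point and has no facets in the sense of [facet_defining],
    whence [1 < n] in the facet clause. *)
Theorem theorem2p2 (R : realType) (n : nat) (odd_n : odd n) :
  [/\ dual_degree_polytope R n =
        [set x | (forall i : nat, (i < n)%N -> xcoord x i.+1 <= xcoord x i) /\
                 \sum_(k < n.-1./2)
                    (xcoord x (2 * k + 1) - xcoord x (2 * k + 2)) <= n.-1%:R],
      (1 < n)%N -> forall f : ineq R n.-1,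
        facet_defining (dual_degree_polytope R n) f <->
        exists2 g, listed_ineqs R n g & positive_multiple f g,
      extreme_points (dual_degree_polytope R n) =
        points_a R n `|` points_b R n `|` points_c R n,
      extreme_points (dual_degree_polytope R n) #= `I_((n + 1) ^ 2 %/ 4) &
      [/\ points_a R n #= `I_((n + 1) %/ 2),
          points_b R n #= `I_((n ^ 2 - 1) %/ 8) &
          points_c R n #= `I_((n ^ 2 - 1) %/ 8)]].
Proof.
rewrite dual_degree_polytopeE // extreme_points_gap_polytope ?odd_gt0 //.
have nE : n = n./2.*2.+1 by rewrite -[LHS]odd_double_half odd_n.
move: {odd_n} (n./2) nE => p ->.
(* With n = 2p + 1, n^2 - 1 = 4p(p + 1), which is 8 times the binomial coefficient. *)
have cE : ((p.*2.+1 ^ 2 - 1) %/ 8 = 'C(p.+1, 2))%N.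
  have := mul_bin_diag p.+1 1; rewrite bin1 /= => H.
  by rewrite (_ : (_ - 1)%N = ('C(p.+1, 2) * 8)%N) ?mulnK //; nia.
split.
- apply/seteqP; split => x [x0 xo]; split.
  + by move=> i ilt; have := x0 (Ordinal ilt); rewrite subr_ge0.
  + by move: xo; rewrite odd_gap_half /= doubleK.
  + by move=> i; rewrite subr_ge0 x0.
  + by move: xo; rewrite odd_gap_half /= doubleK.
- by move=> p0 f; apply: facet_defining_listed; rewrite ?odd_double.
- exact: vertices_points.
- rewrite verticesE (_ : setT = [set q | q \in finset.setT]); last first.
    by apply/seteqP; split => // q _; rewrite /= inE.
  (* (n + 1)^2 / 4 = (p + 1)^2: there are p + 1 even indices, and p odd indices besides [None]. *)
  have -> : ((p.*2.+1 + 1) ^ 2 %/ 4 = #|[set: 'I_p.+1 * option 'I_p]%SET|)%N.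
    rewrite cardsT card_prod card_option !card_ord.
    by rewrite (_ : (_ ^ 2)%N = (p.+1 * p.+1 * 4)%N) ?mulnK //; nia.
  exact/card_image_finset/vtx_of_inj.
- split.
  + rewrite points_aE (_ : (_ %/ 2)%N = #|a_index p|); last by rewrite card_a_index; lia.
    exact/card_image_finset/vtx_of_inj.
  + by rewrite points_bE cE -card_b_index; exact/card_image_finset/vtx_of_inj.
  + by rewrite points_cE cE -card_c_index; exact/card_image_finset/vtx_of_inj.
Qed.
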